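(* Let $\Omega\subset\mathbf{R}^2$ be a smooth, bounded, convex open set, and assume $m=2$. Let $\mu\in\mathcal{A}_d$ and let $\Gamma$ be a $\Lambda(\mu)$-minimizer. Then $\Gamma$ is made of exactly $d$ disjoint segments $\Gamma_1,\dots,\Gamma_d$, and each $\Gamma_k\cap\mathrm{spt}\,\mu$ contains exactly two points $\{p_k,q_k\}$. In particular, $\Gamma_k=[p_k,q_k]$ for each $k$, and $\mathcal{H}^1(\Gamma)$ is the length of a minimal connection between $P=\{p_1,\dots,p_d\}$ and $Q=\{q_1,\dots,q_d\}$.
   Context: $d\ge0$ is an integer, $\mathbf{N}=\{0,1,2,\dots\}$. $\mathcal{A}_d$ is the set of measures $\mu=2\pi\sum_{k=1}^{md}\delta_{x_k}$ with $x_1,\dots,x_{md}$ distinct points of $\Omega$ (here $m=2$). A compact set $\Gamma$ is a $\Lambda(\mu)$-minimizer if it minimizes $\mathcal{H}^1(\Gamma)$ among compact sets $\Gamma$ with $\mathrm{spt}\,\mu\subset\Gamma$ such that every connected component $\Sigma$ of $\Gamma$ satisfies $\mathrm{Card}(\Sigma\cap\mathrm{spt}\,\mu)\in m\mathbf{N}$. Since components containing no point of $\mathrm{spt}\,\mu$ can be removed, the minimization is reduced to sets $\Gamma$ whose connected components all contain a positive number of points of $\mathrm{spt}\,\mu$. For sets $P=\{p_1,\dots,p_d\}$ and $Q=\{q_1,\dots,q_d\}$ of points of $\mathbf{R}^2$, the length of a minimal connection between $P$ and $Q$ is $\min_\sigma\sum_{k=1}^d|p_k-q_{\sigma(k)}|$,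 the minimum running over all permutations $\sigma$ of $\{1,\dots,d\}$. *)

(* Defs.v *)
From HB Require Import structures.
From mathcomp Require Import all_boot all_order all_algebra all_fingroup.
From mathcomp Require Import all_classical all_reals all_analysis.

Set Implicit Arguments.
Unset Strict Implicit.
Unset Printing Implicit Defensive.

Import Order.TTheory GRing.Theory Num.Theory numFieldNormedType.Exports.

Local Open Scope classical_set_scope.
Local Open Scope ring_scope.

(* The plane is R * R. The library norm on a product is the maximum norm: it
   has the right topology and bounded sets, but lengths must be computed with
   the Euclidean distance. *)
Definition edist (R : realType) (x y : R * R) : R :=
  Num.sqrt ((x.1 - y.1) ^+ 2 + (x.2 - y.2) ^+ 2).

Definition segment (R : realType) (x y : R * R) : set (R * R) :=
  [set (1 - t) *: x + t *: y | t in `[0, 1]%classic].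

(* The element 0 is only there to make the diameter of the empty set 0. *)
Definition ediam (R : realType) (A : set (R * R)) : \bar R :=
  ereal_sup (0%E |` [set (edist z.1 z.2)%:E | z in A `*` A]).

Definition hausdorff1_pre (R : realType) (delta : R) (A : set (R * R)) : \bar R :=
  ereal_inf [set (\sum_(0 <= k <oo) ediam (C k))%E
    | C in [set C : nat -> set (R * R) | A `<=` \bigcup_k C k /\
                                  forall k, (ediam (C k) <= delta%:E)%E]].

Definition hausdorff1 (R : realType) (A : set (R * R)) : \bar R :=
  ereal_sup [set hausdorff1_pre delta A | delta in [set delta : R | 0 < delta]].

Definition smooth_fun (R : realType) (g : R -> R) : Prop :=
  forall (n : nat) (t : R), derivable (derive1n n g) t 1.

(* Near each boundary point, after possibly exchanging the two coordinates
   (swap) and reversing an orientation (flip), Omega is the region above the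
   graph of a C^oo function. *)
Definition smooth_domain (R : realType) (Omega : set (R * R)) : Prop :=
  forall z : R * R, (closure Omega `\` Omega°) z ->
  exists (g : R -> R) (swap flip : bool), smooth_fun g /\
    \forall y \near z, Omega y <->
      0 < (-1) ^+ flip * (if swap then y.1 - g y.2 else y.2 - g y.1).

Definition spt (R : realType) (mu : {measure set (R * R) -> \bar R}) :
    set (R * R) :=
  [set x | forall U : set (R * R), open U -> U x -> (0 < mu U)%E].

(* The class A_d: the measures 2 pi sum_k delta_(x_k) with m * d distinct
   points x_k in Omega. *)
Definition atomic_measures (R : realType) (m d : nat) (Omega : set (R * R)) :
    set {measure set (R * R) -> \bar R} :=
  [set mu | exists x : 'I_(m * d) -> R * R,
    [/\ injective x, (forall k, Omega (x k)) &
        forall B : set (R * R), measurable B ->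
          mu B = ((2 * pi)%:E * \sum_(k < m * d) \d_(x k) B)%E]].

Definition Lambda_admissible (R : realType) (m : nat)
    (mu : {measure set (R * R) -> \bar R}) (G : set (R * R)) : Prop :=
  [/\ compact G, spt mu `<=` G &
      forall x, G x -> exists n : nat,
        (connected_component G x `&` spt mu #= `I_(m * n))%card].

Definition Lambda_minimizer (R : realType) (m : nat)
    (mu : {measure set (R * R) -> \bar R}) (G : set (R * R)) : Prop :=
  Lambda_admissible m mu G /\
  forall G', Lambda_admissible m mu G' -> (hausdorff1 G <= hausdorff1 G')%E.

(* The normalization of minimizers by removal of the components that contain
   no point of the support; without it a minimizer could carry superfluous
   components of zero length, such as isolated points. *)
Definition reduced (R : realType) (mu : {measure set (R * R) -> \bar R})
    (G : set (R * R)) : Prop :=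
  forall x, G x -> connected_component G x `&` spt mu !=set0.

Definition connection_length (R : realType) (d : nat) (p q : 'I_d -> R * R)
    (s : {perm 'I_d}) : R :=
  \sum_(k < d) edist (p k) (q (s k)).

Definition minimal_connection (R : realType) (d : nat)
    (p q : 'I_d -> R * R) : R :=
  \big[Num.min/connection_length p q 1%g]_(s : {perm 'I_d})
    connection_length p q s.

(* Main.v *)
From Pilot Require Import Defs.
From HB Require Import structures.
From mathcomp Require Import all_boot all_order all_algebra all_fingroup.
From mathcomp Require Import all_classical all_reals all_analysis.
From mathcomp Require Import ring lra zify.
Import Order.TTheory GRing.Theory Num.Theory numFieldNormedType.Exports.
Local Open Scope classical_set_scope.
Local Open Scope ring_scope.

(** Let [T] be the support of [mu], a set of [2 d] points. The length of a
    minimizer [Gamma] is bounded on both sides by perfect matchings of [T].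

    From above: for every perfect matching of [T] the union of its segments is
    admissible, because a component of that union contains both ends of a
    segment or neither. So [Gamma] is at most as long as every perfect matching
    ([minimizer_le]).

    From below: take a fine cover of [Gamma] by small open sets and pass to
    its intersection graph. Each component of this graph contains an even
    number of points of [T]. In a spanning forest, prune the leaves one by one
    and push every point of [T] towards the root; two points that reach the
    same vertex are matched. Every member of the cover is crossed by at most
    one point on its way, so the total length of the matching is at most the
    sum of the diameters of the cover, up to the mesh times the number of
    points ([forest_pairing]). The same bookkeeping shows more: any point [z]
    of [Gamma] is attached to the forest, and so some matched pair [p], [q]
    has detour [|pz| + |zq| - |pq|] at most twice what the inequality leaves
    over. Because there are finitely many matchings, a single one works for
    arbitrarily fine covers ([limit_pairing]).

    Comparing the two bounds, this matching is minimal, it is as long as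
    [Gamma], and all the detours vanish: [Gamma] lies in the union of its
    segments. Segments of a minimal matching are pairwise disjoint, since
    exchanging partners in two crossing segments would shorten it
    ([uncross], [minimal_disjoint]). Hence a component of [Gamma] lies in a
    single segment [[p, q]]; having an even number of points of [T] it
    contains [p] and [q], and, being connected, all of [[p, q]]. *)

(* [edist] is the Euclidean distance of the plane, not the extended distance
   of a pseudometric space. *)
Local Notation edist := Pilot.Defs.edist.

Set Implicit Arguments.
Unset Strict Implicit.

(** * Euclidean distance and segments *)

Definition dot (R : realType) (u v : R * R) : R := u.1 * v.1 + u.2 * v.2.

Lemma edist_ge0 (R : realType) (x y : R * R) : 0 <= edist x y.
Proof. exact: sqrtr_ge0. Qed.

Lemma edist_sqr (R : realType) (x y : R * R) :
  edist x y ^+ 2 = dot (x - y) (x - y).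
Proof. by rewrite sqr_sqrtr -?expr2// addr_ge0// sqr_ge0. Qed.

Lemma edistC (R : realType) (x y : R * R) : edist x y = edist y x.
Proof. by rewrite /edist -opprB sqrrN -(opprB y.2) sqrrN. Qed.

Lemma edistxx (R : realType) (x : R * R) : edist x x = 0.
Proof. by rewrite /edist !subrr expr0n addr0 sqrtr0. Qed.

Lemma edist_eq0 (R : realType) (x y : R * R) : edist x y = 0 -> x = y.
Proof.
move=> /(congr1 (fun r => r ^+ 2)); rewrite edist_sqr expr0n/= /dot -!expr2.
move/eqP; rewrite paddr_eq0 ?sqr_ge0// !sqrf_eq0 !subr_eq0.
by case: x y => [a b] [c e] /= /andP[/eqP-> /eqP->].
Qed.

Lemma dot_le (R : realType) (x y z : R * R) :
  dot (x - y) (y - z) <= edist x y * edist y z.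
Proof.
have [d0|d0] := leP (dot (x - y) (y - z)) 0.
  by rewrite (le_trans d0)// mulr_ge0 ?edist_ge0.
rewrite -(@ler_pXn2r _ 2)// ?nnegrE ?mulr_ge0 ?edist_ge0 ?(ltW d0)//.
rewrite exprMn !edist_sqr /dot/= -subr_ge0.
set a := x.1 - _; set b := x.2 - _; set c := y.1 - _; set e := y.2 - _.
by rewrite [leRHS](_ : _ = (a * e - b * c) ^+ 2) ?sqr_ge0//; ring.
Qed.

Lemma edist_cosine (R : realType) (x y z : R * R) :
  edist x z ^+ 2 =
  edist x y ^+ 2 + edist y z ^+ 2 + 2 * dot (x - y) (y - z).
Proof. by rewrite !edist_sqr /dot/=; ring. Qed.

Lemma edist_triangle (R : realType) (y x z : R * R) :
  edist x z <= edist x y + edist y z.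
Proof.
rewrite -(@ler_pXn2r _ 2)// ?nnegrE ?addr_ge0 ?edist_ge0//.
rewrite (edist_cosine x y z) sqrrD -mulr_natl.
have := dot_le x y z; lra.
Qed.

Lemma edist_add_dot (R : realType) (x y z : R * R) :
  edist x z = edist x y + edist y z ->
  dot (x - y) (y - z) = edist x y * edist y z.
Proof.
move=> /(congr1 (fun r => r ^+ 2)).
by rewrite (edist_cosine x y z) sqrrD -mulr_natl; lra.
Qed.

Lemma comb_fst (R : realType) (x y : R * R) (s t : R) :
  (s *: x + t *: y).1 = s * x.1 + t * y.1.
Proof. by []. Qed.

Lemma comb_snd (R : realType) (x y : R * R) (s t : R) :
  (s *: x + t *: y).2 = s * x.2 + t * y.2.
Proof. by []. Qed.

(** Equality in the triangle inequality is equality in the Cauchy-Schwarz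
    inequality, which makes [x - y] and [y - z] parallel. *)
Lemma edist_between (R : realType) (x y z : R * R) :
  edist x y + edist y z <= edist x z -> segment x z y.
Proof.
move=> le_xz.
have eq_xz : edist x z = edist x y + edist y z.
  by apply/eqP; rewrite eq_le edist_triangle.
have := edist_add_dot eq_xz.
have := edist_sqr x y; have := edist_sqr y z.
have := edist_ge0 x y; have := edist_ge0 y z.
set b := edist y z in eq_xz *; set a := edist x y in eq_xz *.
move=> b0 a0 eb ea ab.
have [c0|c0] := eqVneq (edist x z) 0.
  have /edist_eq0 <- : edist x y = 0 by rewrite -/a; lra.
  exists 0; first by rewrite /= in_itv/= lexx ler01.
  by rewrite subr0 scale1r scale0r addr0.
have cp : 0 < a + b by rewrite -eq_xz lt_neqAle eq_sym c0 edist_ge0.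
exists (a / (a + b)).
  rewrite /= in_itv/=; apply/andP; split.
    by rewrite divr_ge0// ltW.
  by rewrite ler_pdivrMr//; lra.
(* b (x - y) = a (y - z): the squared norm of the difference vanishes. *)
have /eqP : (b * (x.1 - y.1) - a * (y.1 - z.1)) ^+ 2 +
            (b * (x.2 - y.2) - a * (y.2 - z.2)) ^+ 2 = 0.
  rewrite [LHS](_ : _ = b ^+ 2 * dot (x - y) (x - y) +
    a ^+ 2 * dot (y - z) (y - z) - 2 * a * b * dot (x - y) (y - z)); last first.
    by rewrite /dot/=; ring.
  by rewrite -ea -eb ab; ring.
rewrite paddr_eq0 ?sqr_ge0// !sqrf_eq0 => /andP[/eqP e1 /eqP e2].
have cn : a + b != 0 by rewrite gt_eqF.
set t := a / (a + b); have tE : t * (a + b) = a by rewrite divfK.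
clear - e1 e2 cn tE.
apply: injective_projections; rewrite ?comb_fst ?comb_snd; apply: (mulfI cn).
- transitivity (b * x.1 + a * z.1 + (a - t * (a + b)) * (x.1 - z.1)); first by ring.
  by rewrite tE; lra.
- transitivity (b * x.2 + a * z.2 + (a - t * (a + b)) * (x.2 - z.2)); first by ring.
  by rewrite tE; lra.
Qed.

Lemma dotBB (R : realType) (x y z t : R * R) :
  dot (x - y) (z - t) =
  (x.1 - y.1) * (z.1 - t.1) + (x.2 - y.2) * (z.2 - t.2).
Proof. by []. Qed.

Lemma edist_segment (R : realType) (x y : R * R) (s t : R) :
  edist ((1 - s) *: x + s *: y) ((1 - t) *: x + t *: y) =
  `|s - t| * edist x y.
Proof.
apply/eqP; rewrite -(@eqrXn2 _ 2)// ?mulr_ge0 ?edist_ge0//.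
rewrite exprMn real_normK ?num_real// !edist_sqr; apply/eqP.
by rewrite !dotBB !comb_fst !comb_snd; ring.
Qed.

Lemma segment_left (R : realType) (x y : R * R) : segment x y x.
Proof.
exists 0; first by rewrite /= in_itv/= lexx ler01.
by rewrite subr0 scale1r scale0r addr0.
Qed.

Lemma segmentC (R : realType) (x y : R * R) : segment x y = segment y x.
Proof.
suff H (u v : R * R) : segment u v `<=` segment v u.
  by apply/seteqP; split; exact: H.
move=> _ [t + <-]; rewrite /= in_itv/= => /andP[t0 t1]; exists (1 - t).
  by rewrite /= in_itv/=; apply/andP; split; lra.
by rewrite opprB addrC addrCA subrr addr0.
Qed.

Lemma segment_right (R : realType) (x y : R * R) : segment x y y.
Proof. by rewrite segmentC; exact: segment_left. Qed.

Lemma segment_edist (R : realType) (x y z : R * R) :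
  segment x y z -> edist x z + edist z y = edist x y.
Proof.
move=> [t + <-]; rewrite /= in_itv/= => /andP[t0 t1].
have -> : edist x ((1 - t) *: x + t *: y) = t * edist x y.
  have := edist_segment x y 0 t.
  rewrite subr0 scale1r scale0r addr0 => ->.
  by rewrite sub0r normrN ger0_norm.
have -> : edist ((1 - t) *: x + t *: y) y = (1 - t) * edist x y.
  have := edist_segment x y t 1.
  rewrite subrr scale1r scale0r add0r => ->.
  by rewrite distrC ger0_norm ?subr_ge0.
by ring.
Qed.

(** Three unit vectors with pairwise inner products -1 would have a sum of
    squared norm -3; so one of the three points is [z]. *)
Lemma between_triple (R : realType) (z a b c : R * R) :
  edist a b = edist a z + edist z b -> edist b c = edist b z + edist z c ->
  edist a c = edist a z + edist z c -> [\/ a = z, b = z | c = z].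
Proof.
move=> /edist_add_dot ab /edist_add_dot bc /edist_add_dot ac.
have ea := edist_sqr a z; have eb := edist_sqr b z; have ec := edist_sqr c z.
rewrite [edist z b]edistC in ab.
rewrite [edist z c]edistC in bc ac.
set A := edist a z in ab bc ac ea; set B := edist b z in ab bc ac eb.
set C := edist c z in ab bc ac ec.
pose S i := B * C * (i a - i z : R) + A * C * (i b - i z) + A * B * (i c - i z).
have SS : S fst ^+ 2 + S snd ^+ 2 = - 3 * (A * B * C) ^+ 2.
  transitivity (B ^+ 2 * C ^+ 2 * dot (a - z) (a - z) +
    A ^+ 2 * C ^+ 2 * dot (b - z) (b - z) +
    A ^+ 2 * B ^+ 2 * dot (c - z) (c - z) -
    2 * (A * B * C ^+ 2 * dot (a - z) (z - b) +
         A * B ^+ 2 * C * dot (a - z) (z - c) +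
         A ^+ 2 * B * C * dot (b - z) (z - c))).
    by rewrite /S /dot/=; ring.
  by rewrite ab bc ac -ea -eb -ec; ring.
have /eqP : (A * B * C) ^+ 2 = 0.
  have := sqr_ge0 (S fst); have := sqr_ge0 (S snd).
  have := sqr_ge0 (A * B * C); lra.
rewrite sqrf_eq0 !mulf_eq0 -orbA => /or3P[]/eqP/edist_eq0.
- by constructor 1.
- by constructor 2.
- by constructor 3.
Qed.

(** Neither exchange of partners lengthens two crossing segments, by the
    triangle inequality at the crossing point. If neither shortens them, that
    point lies between any two of the four endpoints, against
    [between_triple]. *)
Lemma uncross (R : realType) (a b c e : R * R) :
  uniq [:: a; b; c; e] ->
  edist a b + edist c e <= edist a c + edist b e ->
  edist a b + edist c e <= edist a e + edist b c ->
  segment a b `&` segment c e = set0.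
Proof.
move=> un l1 l2; apply/seteqP; split=> // z [/segment_edist ab /segment_edist ce].
exfalso; move: ab ce l1 l2.
have t1 := edist_triangle z a c; have t2 := edist_triangle z b e.
have t3 := edist_triangle z a e; have t4 := edist_triangle z b c.
move=> ab ce l1 l2.
have cz := edistC z c; have bz := edistC z b; have ez := edistC z e.
have Hab : edist a b = edist a z + edist z b by lra.
have Hac : edist a c = edist a z + edist z c by lra.
have Hae : edist a e = edist a z + edist z e by lra.
have Hbc : edist b c = edist b z + edist z c by lra.
have Hbe : edist b e = edist b z + edist z e by lra.
have Hce : edist c e = edist c z + edist z e by lra.
have := between_triple Hab Hbc Hac; have := between_triple Hab Hbe Hae.
have := between_triple Hac Hce Hae; have := between_triple Hbc Hce Hbe.
move: un; rewrite /= !inE !negb_or -!andbA => /and5P[nab nac nae nbc].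
move=> /and3P[nbe nce _].
clear -nab nac nae nbc nbe nce.
by do 4![case=> ?]; subst; rewrite ?eqxx in nab nac nae nbc nbe nce.
Qed.

(** * Pairing the terminals along a forest *)

Definition pairs_length (R : realType) (J : Type) (pos : J -> R * R)
    (prs : seq (J * J)) : R :=
  \sum_(e <- prs) edist (pos e.1) (pos e.2).

Definition detour (R : realType) (p q z : R * R) : R :=
  edist p z + edist z q - edist p q.

(** The sets of vertices for which the parity of the number of terminals is
    known: the unions of components of the intersection graph. *)
Definition saturated (R : realType) (I : Type) (C : I -> set (R * R))
    (D : pred I) : Prop :=
  forall i j, C i `&` C j !=set0 -> D i = D j.

(** A spanning forest of the intersection graph, recorded as the order in which
    its leaves are pruned: the head of the list either meets some later vertex,
    its parent, or is the root of its tree, and then the rest of the list is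
    made of whole trees. The predicate [root] tells which vertices are allowed
    as roots. *)
Fixpoint forest_order (R : realType) (I : eqType) (C : I -> set (R * R))
    (root : pred I) (l : seq I) : Prop :=
  if l is v :: l' then
    [/\ forest_order C root l', v \notin l' &
        (root v /\ saturated C (mem l')) \/
        exists2 u, u \in l' & C v `&` C u !=set0]
  else True.

(** The token of the terminal [j] sits at the vertex [loc j], and has come there
    at the expense [r j]. A point [z] is followed in the same way, at the
    expense [s]: it waits at a vertex of [A] until a token passes, and is then
    recorded as a detour on the route of that token. A detour by a point at
    distance [s] from a route costs [2 * s]; the term [delta] is spent once,
    when the token picks up [z]. *)
Definition marked (R : realType) (I J : eqType) (C : I -> set (R * R))
    (delta : R) (pos : J -> R * R) (A : seq I) (js : seq J) (loc : J -> I)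
    (r : J -> R) (z : R * R) (s : R) : Prop :=
  (exists v y, [/\ v \in A, C v y & edist z y + delta <= s]) \/
  (exists j y, [/\ j \in js, C (loc j) y &
                 edist (pos j) z + edist z y <= r j + 2 * s]).

Lemma perm_rem_pair (J : eqType) (js : seq J) (P : pred J) :
  uniq js -> (1 < count P js)%N ->
  exists a b js', [/\ P a, P b & perm_eq js (a :: b :: js')].
Proof.
move=> ujs; rewrite -size_filter.
have uf := filter_uniq P ujs.
case E : [seq x <- js | P x] => [|a [|b t]]// _.
have inP x : x \in a :: b :: t -> P x && (x \in js).
  by rewrite -E mem_filter.
exists a, b, (rem b (rem a js)).
have /andP[Pa ja] : P a && (a \in js) by apply: inP; rewrite !inE eqxx.
have /andP[Pb jb] : P b && (b \in js) by apply: inP; rewrite !inE eqxx orbT.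
split=> //; rewrite (permPl (perm_to_rem ja)) perm_cons perm_to_rem//.
rewrite mem_rem_uniq// inE jb andbT.
by move: uf; rewrite E /= inE negb_or eq_sym -andbA => /andP[].
Qed.

(** The head [v] of the list is pruned. Tokens at [v] are matched two by two,
    each match costing one diameter; a token left alone moves to the parent of
    [v] and takes over the weight of [v], which nobody else uses. Moving and
    matching preserve the parity of the number of tokens in every saturated
    set, so no token is left at a root. A point waiting at [v] moves with the
    token if there is one, or else takes the unused weight of [v] along; it is
    caught at the latest at the root, where a terminal sits. The same expense
    bounds the length of the pair and its length by way of [z]; the mean of
    the two is the length plus half of the detour.

    The set [A] of vertices where points may wait excludes [v] once some match
    has been made at [v], because a root may be left without token then. *)
Lemma forest_pairing (R : realType) (I J : eqType) (C : I -> set (R * R))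
    (w : I -> R) (delta : R) (pos : J -> R * R) (root : pred I)
    (Cw : forall i y z, C i y -> C i z -> edist y z <= w i)
    (w0 : forall i, 0 <= w i) (wd : forall i, w i <= delta) (d0 : 0 <= delta)
    (n : nat) (l A : seq I) (js : seq J) (loc : J -> I) (r : J -> R) :
  (size l + size js <= n)%N ->
  forest_order C root l -> A = l \/ A = behead l -> uniq js ->
  (forall v, v \in A -> root v -> exists2 j, j \in js & loc j = v) ->
  (forall j, j \in js -> loc j \in l) ->
  (forall j, j \in js -> exists2 y, C (loc j) y & edist (pos j) y <= r j) ->
  (forall D, saturated C D -> ~~ odd (count (fun j => D (loc j)) js)) ->
  exists prs : seq (J * J),
    [/\ perm_eq (unzip1 prs ++ unzip2 prs) js,
        pairs_length pos prs <= \sum_(j <- js) r j + \sum_(v <- l) w v +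
                                (size js)%:R * delta &
        forall z s, marked C delta pos A js loc r z s ->
          exists2 e, e \in prs &
            pairs_length pos prs + detour (pos e.1) (pos e.2) z / 2 <=
            \sum_(j <- js) r j + \sum_(v <- l) w v + (size js)%:R * delta + s].
Proof.
elim: n l A js loc r => [|n IHn] [|v l] A js loc r szn ford HA ujs rootA locl
  reach ev.
1,3: have js0 : js = [::]
  by (case: (js) locl => // j t /(_ j); rewrite inE eqxx => /(_ isT)).
1,2: subst js; have {HA} -> : A = [::] by case: HA.
1,2: exists [::]; split=> //; first by rewrite /pairs_length !big_nil mul0r !addr0.
1,2: by move=> z s [[? [? []]]|[? [? []]]].
  by [].
move: szn ford => /= szn [ford vl ifroot].
have A_sub x : x \in A -> x = v \/ x \in l.
  by case: HA => -> /=; [rewrite inE => /orP[/eqP|]; [left|right]|right].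
have l_sub x : x \in l -> x \in A.
  by case: HA => -> //; rewrite inE orbC => ->.
rewrite big_cons.
have [k1|k2] := ltnP 1 (count (fun j => loc j == v) js).
  have [a [b [js' [/eqP va /eqP vb pjs]]]] := perm_rem_pair ujs k1.
  have mjs := perm_mem pjs.
  have [prs [pprs len mk]] : exists prs : seq (J * J),
    [/\ perm_eq (unzip1 prs ++ unzip2 prs) js',
        pairs_length pos prs <= \sum_(j <- js') r j +
           \sum_(v <- v :: l) w v + (size js')%:R * delta &
        forall z s, marked C delta pos l js' loc r z s ->
          exists2 e, e \in prs &
            pairs_length pos prs + detour (pos e.1) (pos e.2) z / 2 <=
            \sum_(j <- js') r j + \sum_(v <- v :: l) w v +
            (size js')%:R * delta + s].
    apply: (IHn (v :: l) l js' loc r) => //=.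
    - by move: szn; rewrite (perm_size pjs)/= !addnS !ltnS => /ltnW.
    - by right.
    - by move: ujs; rewrite (perm_uniq pjs) => /and3P[].
    - move=> x xl xr; have [j jj jx] := rootA _ (l_sub _ xl) xr.
      exists j => //; move: jj; rewrite mjs !inE => /or3P[/eqP ja|/eqP jb|//].
        by move: xl vl; rewrite -jx ja va => ->.
      by move: xl vl; rewrite -jx jb vb => ->.
    - by move=> j jj; apply: locl; rewrite mjs !inE jj !orbT.
    - by move=> j jj; apply: reach; rewrite mjs !inE jj !orbT.
    - move=> D /ev; rewrite (seq.permP pjs)/= va vb addnA oddD.
      by rewrite addnn odd_double.
  have [ya Cya aya] : exists2 y, C v y & edist (pos a) y <= r a.
    by rewrite -va; apply: reach; rewrite mjs !inE eqxx.
  have [yb Cyb byb] : exists2 y, C v y & edist (pos b) y <= r b.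
    by rewrite -vb; apply: reach; rewrite mjs !inE eqxx orbT.
  have ab : edist (pos a) (pos b) <= r a + r b + delta.
    have := edist_triangle ya (pos a) (pos b).
    have := edist_triangle yb ya (pos b); rewrite (edistC yb).
    have := Cw _ _ _ Cya Cyb; have := wd v; lra.
  have sumr : \sum_(j <- js) r j = r a + (r b + \sum_(j <- js') r j).
    by rewrite (perm_big _ pjs)/= !big_cons.
  have szjs : (size js)%:R = 2 + (size js')%:R :> R.
    by rewrite (perm_size pjs)/= -natrD.
  rewrite sumr szjs; rewrite big_cons in len mk.
  exists ((a, b) :: prs); split.
  - rewrite perm_sym (permPl pjs) /= perm_cons perm_sym.
    by rewrite -(cat1s b) perm_catCA /= perm_cons.
  - by rewrite /pairs_length big_cons/= -/(pairs_length pos prs); lra.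
  have pl : pairs_length pos ((a, b) :: prs) =
      edist (pos a) (pos b) + pairs_length pos prs.
    by rewrite /pairs_length big_cons.
  have here z s : edist (pos a) z + edist z (pos b) <= r a + r b + 2 * delta + 2 * s ->
      exists2 e, e \in (a, b) :: prs & pairs_length pos ((a, b) :: prs) +
        detour (pos e.1) (pos e.2) z / 2 <=
        r a + (r b + \sum_(j <- js') r j) + (w v + \sum_(j <- l) w j) +
        (2 + (size js')%:R) * delta + s.
    by move=> zab; exists (a, b); rewrite ?inE ?eqxx//= pl /detour; lra.
  have later z s : marked C delta pos l js' loc r z s ->
      exists2 e, e \in (a, b) :: prs & pairs_length pos ((a, b) :: prs) +
        detour (pos e.1) (pos e.2) z / 2 <=
        r a + (r b + \sum_(j <- js') r j) + (w v + \sum_(j <- l) w j) +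
        (2 + (size js')%:R) * delta + s.
    move=> /mk [e ee le]; exists e; first by rewrite inE ee orbT.
    by rewrite pl; lra.
  move=> z s [[x [y [xA Cxy zy]]]|[j [y [jjs Cjy jz]]]].
    have [xv|xl] := A_sub _ xA; last by apply: later; left; exists x, y.
    rewrite xv in Cxy; apply: here.
    have := edist_triangle ya (pos a) z; have := edist_triangle yb z (pos b).
    have := edist_triangle y ya z; have := edist_triangle y z yb.
    have := Cw _ _ _ Cya Cxy; have := Cw _ _ _ Cxy Cyb; have := wd v.
    rewrite (edistC yb) (edistC y z); lra.
  move: jjs Cjy jz; rewrite mjs !inE => /or3P[/eqP->|/eqP->|jjs].
  - rewrite va => Cvy jz; apply: here.
    have := edist_triangle y z (pos b); have := edist_triangle yb y (pos b).
    have := Cw _ _ _ Cvy Cyb; have := wd v.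
    rewrite (edistC yb); lra.
  - rewrite vb => Cvy jz; apply: here.
    have := edist_triangle y (pos a) z; have := edist_triangle ya (pos a) y.
    have := Cw _ _ _ Cya Cvy; have := wd v.
    rewrite (edistC y z) (edistC z (pos b)); lra.
  - by move=> Cjy jz; apply: later; right; exists j, y.
have kE : (count (fun j => loc j == v) js = 0 \/
           count (fun j => loc j == v) js = 1)%N.
  by move: k2; case: count => [|[|]]//; [left|right].
case: ifroot => [[rv sat]|[u ul [y0 [Cv0 Cu0]]]].
  have k0 : count (fun j => loc j == v) js = 0%N.
    case: kE => // k1.
    have cE : count (predC (fun j => loc j == v)) js =
              count (fun j => mem l (loc j)) js.
      apply: eq_in_count => j jj /=; have := locl _ jj; rewrite inE.
      by case: eqP => [->|_ /= ->]//; rewrite (negbTE vl).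
    have := ev _ sat; have := ev predT (fun _ _ _ => erefl).
    rewrite count_predT -(count_predC (fun j => loc j == v) js) k1 cE oddD /=.
    by case: odd.
  have no j : j \in js -> loc j != v.
    move=> jj; apply/negP => jv; have : has (fun j => loc j == v) js.
      by apply/hasP; exists j.
    by rewrite has_count k0.
  (* [v] has no token, whereas the roots in [A] carry one. *)
  have Al : A = l.
    case: HA => // AE; have [j /no] : exists2 j, j \in js & loc j = v.
      by apply: rootA => //; rewrite AE inE eqxx.
    by move=> /eqP.
  subst A.
  have [||prs [pprs len mk]] :=
    IHn l l js loc r _ ford (or_introl erefl) ujs rootA _ reach ev.
  - by rewrite -ltnS.
  - by move=> j jj; have := locl _ jj; rewrite inE (negbTE (no _ jj)).
  exists prs; split=> //; first by have := w0 v; lra.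
  by move=> z s /mk[e ee le]; exists e => //; have := w0 v; lra.
(* Vertex [v] has a parent [u], to which its only token moves, if any. *)
pose loc' j := if loc j == v then u else loc j.
pose r' j := r j + (if loc j == v then w v else 0).
have sumr' : \sum_(j <- js) r' j =
    \sum_(j <- js) r j + w v *+ count (fun j => loc j == v) js.
  rewrite /r' big_split/= -big_mkcond/= big_const_seq iter_addr_0//.
have [|||||prs [pprs len mk]] := IHn l l js loc' r' _ ford (or_introl erefl) ujs.
- by rewrite -ltnS.
- move=> x xl xr; have [j jj jx] := rootA _ (l_sub _ xl) xr.
  exists j => //; rewrite /loc' ifF// jx; apply/negP => /eqP xv.
  by move: xl; rewrite xv (negbTE vl).
- move=> j jj; rewrite /loc'; have := locl _ jj; rewrite inE.
  by case: eqP => //.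
- move=> j jj; have [y Cy jy] := reach _ jj; rewrite /loc' /r'.
  case: eqP => [jv|_]; last by exists y; rewrite ?addr0.
  rewrite jv in Cy; exists y0 => //.
  by have := edist_triangle y (pos j) y0; have := Cw _ _ _ Cy Cv0; lra.
- move=> D sD; rewrite (@eq_count _ _ (fun j => D (loc j))) ?ev//.
  move=> j; rewrite /loc'; case: eqP => [->|//].
  by apply/esym/sD; exists y0.
have kw : w v *+ count (fun j => loc j == v) js <= w v.
  by case: kE => ->; rewrite ?mulr0n ?mulr1n.
exists prs; split=> //; first by rewrite sumr' in len; lra.
rewrite sumr' in mk.
have later z s : marked C delta pos l js loc' r' z s -> exists2 e, e \in prs &
    pairs_length pos prs + detour (pos e.1) (pos e.2) z / 2 <=
    \sum_(j <- js) r j + (w v + \sum_(j <- l) w j) + (size js)%:R * delta + s.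
  by move=> /mk[e ee le]; exists e => //; lra.
move=> z s [[x [y [xA Cxy zy]]]|[j [y [jjs Cjy jz]]]].
  have [xv|xl] := A_sub _ xA; last by apply: later; left; exists x, y.
  rewrite xv in Cxy.
  have t0 := edist_triangle y z y0; have c0 := Cw _ _ _ Cxy Cv0.
  have wdv := wd v.
  case: kE => kE.
    have [|e ee le] := mk z (s + w v).
      by left; exists u, y0; split=> //; lra.
    by exists e => //; rewrite kE mulr0n in le; lra.
  have : has (fun j => loc j == v) js by rewrite has_count kE.
  move=> /hasP[j jj /eqP jv]; apply: later; right; exists j, y0.
  split=> //; rewrite /loc' /r' jv eqxx//.
  have [y1 Cy1 jy1] := reach _ jj; rewrite jv in Cy1.
  have := edist_triangle y1 (pos j) z; have := edist_triangle y y1 z.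
  have := Cw _ _ _ Cy1 Cxy; rewrite (edistC y z); lra.
apply: later; right; rewrite /loc' /r'.
have [jv|jv] := eqVneq (loc j) v; last first.
  by exists j, y; split=> //; rewrite (negbTE jv) ?addr0.
rewrite jv in Cjy; exists j, y0; split=> //; rewrite jv eqxx//.
have := edist_triangle y z y0; have := Cw _ _ _ Cjy Cv0; lra.
Qed.

(** * Spanning forests and parity *)

Lemma forest_order_uniq (R : realType) (I : eqType) (C : I -> set (R * R))
    (root : pred I) (l : seq I) : forest_order C root l -> uniq l.
Proof. by elim: l => //= v l IHl [/IHl-> -> _]. Qed.

(** Grow the list by adding a vertex that meets it, as long as there is one;
    when there is none the list is saturated, and so is its complement, which
    therefore contains a vertex allowed as a root. *)
Lemma forest_order_exists (R : realType) (I : eqType) (C : I -> set (R * R))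
    (root : pred I) (L : seq I) :
  (forall i, C i !=set0 -> i \in L) ->
  (forall D, saturated C D -> forall i, i \in L -> D i ->
     exists j, [/\ j \in L, D j & root j]) ->
  exists2 l, forest_order C root l & l =i L.
Proof.
move=> CL rootL.
have grow n : exists l, [/\ forest_order C root l, {subset l <= L} &
    {subset L <= l} \/ size l = n].
  elim: n => [|n [l [fl lL Ll]]]; first by exists [::]; split=> //; right.
  have [Ll'|Ll'] := pselect {subset L <= l}; first by exists l; split=> //; left.
  case: Ll => // sl.
  have [i iL il] : exists2 i, i \in L & i \notin l.
    apply: contrapT => no; apply: Ll' => i iL; apply: contrapT => /negP il.
    by apply: no; exists i.
  have [[v [vL vl [u ul vu]]]|nov] := pselect (exists v, [/\ v \in L, v \notin l &
      exists2 u, u \in l & C v `&` C u !=set0]).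
    exists (v :: l); split=> /=; last by right; rewrite sl.
    - by split=> //; right; exists u.
    - by move=> x; rewrite inE => /orP[/eqP->|/lL].
  have sat : saturated C (mem l).
    have key x y : C x `&` C y !=set0 -> x \in l -> y \in l.
      move=> xy xl; apply: contrapT => /negP yl; apply: nov; exists y; split=> //.
        by apply: CL; case: xy => t [_ ?]; exists t.
      by exists x => //; rewrite setIC.
    move=> x y xy; apply/idP/idP; apply: key => //.
    by rewrite setIC.
  have [|v [vL vl rv]] := rootL (fun x => x \notin l) _ i iL il.
    by move=> x y /sat; rewrite /= => ->.
  exists (v :: l); split=> /=; last by right; rewrite sl.
  - by split=> //; left.
  - by move=> x; rewrite inE => /orP[/eqP->|/lL].
have [l [fl lL [Ll|sl]]] := grow (size L).+1.
  by exists l => // i; apply/idP/idP; [exact: lL|exact: Ll].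
have := uniq_leq_size (forest_order_uniq fl) lL.
by rewrite sl ltnn.
Qed.

Lemma odd_count_classes (J : eqType) (e : rel J) (D : pred J) (js : seq J) :
  symmetric e -> transitive e -> {in js, reflexive e} ->
  {in js, forall j, ~~ odd (count (e j) js)} ->
  {in js &, forall i j, e i j -> D i = D j} ->
  ~~ odd (count D js).
Proof.
move=> esym etr; move: {2}(size js) (leqnn (size js)) => n.
elim: n js => [|n IHn] js; first by case: js.
case E : js => [//|j t]; rewrite -E => szn erefl ev De.
have jj : j \in js by rewrite E inE eqxx.
pose js' := [seq i <- js | ~~ e j i].
have js'P i : i \in js' -> ~~ e j i /\ i \in js.
  by rewrite mem_filter => /andP[].
rewrite -(seq.permP (introT permPl (perm_filterC (e j) js))) count_cat oddD.
have -> : odd (count D [seq i <- js | e j i]) = false.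
  rewrite (@eq_in_count _ D (fun => D j)); last first.
    by move=> i; rewrite mem_filter => /andP[ji ii]; rewrite -(De j i).
  case: (D j); last by rewrite count_pred0.
  by rewrite count_predT size_filter; apply/negbTE/ev.
apply: (IHn js').
- move: szn; rewrite /js' E /= (erefl _ jj)/= size_filter ltnS => /(leq_trans _).
  by apply; rewrite count_size.
- by move=> i /js'P[_ /erefl].
- move=> i /js'P[ji ii]; suff -> : count (e i) js' = count (e i) js by exact: ev.
  rewrite count_filter; apply: eq_in_count => k kk /=.
  case ik : (e i k) => //=; apply: contraNT ji; rewrite negbK => jk.
  by rewrite (etr k)// esym.
- by move=> x y /js'P[_ xx] /js'P[_ yy]; exact: De.
Qed.

(** A connected component of [G] meets members of the cover [C] from a single
    class: those of the class and those outside it cut out two complementary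
    relatively open subsets. *)
Lemma saturated_component (R : realType) (I : Type) (P : set I)
    (U : I -> set (R * R)) (G : set (R * R)) (C : I -> set (R * R))
    (D : pred I) (i j : I) (x y : R * R) :
  (forall k, P k -> open (U k)) -> G `<=` \bigcup_(k in P) U k ->
  (forall k z, C k z <-> [/\ P k, U k z & G z]) -> saturated C D ->
  connected_component G x y -> C i x -> C j y -> D i = D j.
Proof.
move=> Uo GU CE sD xy Cix Cjy.
have xx : connected_component G x x.
  by apply: connected_component_refl; case/CE: Cix.
pose V b := \bigcup_(k in [set k | P k /\ D k = b]) U k.
have Vo b : open (V b) by apply: bigcup_open => k [/Uo].
set K := connected_component G x in xy xx.
have KE : K `&` V (D i) = K.
  apply: (@component_connected _ G x).
  - exists x; split=> //; case/CE: Cix => Pi Ui _.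
    by exists i.
  - by exists (V (D i)).
  - exists (~` V (~~ D i)); first exact: open_closedC.
    apply/seteqP; split=> z [Kz] zV; split=> //.
      move=> [k [Pk kD] Uk]; case: zV => l [Pl lD] Ul.
      have Gz : G z := connected_component_sub Kz.
      have : D k = D l by apply: sD; exists z; split; apply/CE.
      by rewrite kD lD; case: (D i).
    have [k Pk Uk] := GU _ (connected_component_sub Kz).
    exists k => //; split=> //; apply: contrapT => kD; apply: zV.
    by exists k => //; split=> //; case: (D k) (D i) kD => -[].
have [_ [k [Pk <-] Uk]] : (K `&` V (D i)) y by rewrite KE.
apply: sD; exists y; split=> //; apply/CE; split=> //.
exact: connected_component_sub xy.
Qed.

(** * Pairings from covers *)

Lemma continuous_edist (R : realType) (c : R * R) :
  continuous (edist c).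
Proof.
move=> x; rewrite /edist.
apply: (@continuous_comp _ _ _ (fun x : R * R => (c.1 - x.1) ^+ 2 + (c.2 - x.2) ^+ 2)
  (@Num.sqrt R)); last exact: sqrt_continuous.
by apply: cvgD; rewrite expr2; apply: cvgM; apply: cvgB; (try exact: cvg_cst);
  (try exact: cvg_fst); exact: cvg_snd.
Qed.

(** Members of a cover are thickened into open sets, so that finitely many of
    them suffice. *)
Definition thickening (R : realType) (A : set (R * R)) (e : R) : set (R * R) :=
  \bigcup_(c in A) [set x | edist c x < e].

Lemma open_thickening (R : realType) (A : set (R * R)) (e : R) :
  open (thickening A e).
Proof.
apply: bigcup_open => c _.
have : open (edist c @^-1` [set r | r < e]).
  by apply: open_comp => [x _|]; [exact: continuous_edist|exact: open_lt].
by [].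
Qed.

Lemma ediam_ge0 (R : realType) (A : set (R * R)) : (0 <= ediam A)%E.
Proof. by apply: ereal_sup_ubound; left. Qed.

Lemma le_ediam (R : realType) (A : set (R * R)) (x y : R * R) :
  A x -> A y -> ((edist x y)%:E <= ediam A)%E.
Proof. by move=> Ax Ay; apply: ereal_sup_ubound; right; exists (x, y). Qed.

Lemma ediam_le (R : realType) (A : set (R * R)) (d : R) : 0 <= d ->
  (forall x y, A x -> A y -> edist x y <= d) -> (ediam A <= d%:E)%E.
Proof.
move=> d0 Ad; apply: ge_ereal_sup => _ [->|[[x y] [/= Ax Ay] <-]].
  by rewrite lee_fin.
by rewrite lee_fin; exact: Ad.
Qed.

Lemma compact_cover_plane (R : realType) (A : set (R * R)) :
  compact A -> cover_compact A.
Proof.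
pose T : ptopologicalType :=
  HB.pack (R * R)%type (Pointed.on (R * R)%type) (Topological.on (R * R)%type).
by move=> cA; have : @compact T A by []; rewrite compact_cover.
Qed.

(** Thicken a nearly optimal cover of mesh [delta], so little that the diameters
    grow by at most [delta] altogether, extract a finite cover and apply
    [forest_pairing] to its nonempty traces on [G]. A saturated set of members
    covers a union of components of [G]: it contains an even number of
    terminals, and at least one to serve as a root.

    In the error term, the mesh of the thickened cover is [2 * delta]; it is
    paid once for each terminal and once for [z]. The other [2 * delta] come
    from the thickening and from the choice of the cover. *)
Lemma cover_pairing (R : realType) (J : eqType) (pos : J -> R * R)
    (js : seq J) (G : set (R * R)) (h delta : R) :
  uniq js -> compact G -> 0 < delta -> (forall j, j \in js -> G (pos j)) ->
  (forall j, j \in js -> ~~ odd (count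
     (fun k => `[< connected_component G (pos j) (pos k) >]) js)) ->
  (forall x, G x -> exists2 j, j \in js & connected_component G x (pos j)) ->
  (hausdorff1_pre delta G <= h%:E)%E ->
  exists prs : seq (J * J),
    [/\ perm_eq (unzip1 prs ++ unzip2 prs) js,
        pairs_length pos prs <= h + (2 * (size js)%:R + 4) * delta &
        forall z, G z -> exists2 e, e \in prs &
          pairs_length pos prs + detour (pos e.1) (pos e.2) z / 2 <=
          h + (2 * (size js)%:R + 4) * delta].
Proof.
move=> ujs cG d0 Gjs ev redG Hh.
have [S [GS Sd Sh]] : exists S : nat -> set (R * R), [/\ G `<=` \bigcup_k S k,
    forall k, (ediam (S k) <= delta%:E)%E &
    (\sum_(0 <= k <oo) ediam (S k) < (h + delta)%:E)%E].
  have : (hausdorff1_pre delta G < (h + delta)%:E)%E.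
    by rewrite (le_lt_trans Hh)// lte_fin ltrDl.
  by move=> /ereal_inf_lt[_ [S [GS Sd] <-] Sh]; exists S.
pose eta k : R := delta / 2 / (2 ^ k.+1)%:R.
have p2 k : 0 < (2 ^ k.+1)%:R :> R by rewrite ltr0n expn_gt0.
have eta0 k : 0 < eta k by rewrite divr_gt0// divr_gt0.
have etad k : eta k <= delta / 2.
  rewrite ler_pdivrMr// -{1}[delta / 2]mulr1 ler_pM2l ?divr_gt0//.
  by rewrite ler1n expn_gt0.
pose U k := thickening (S k) (eta k).
have GU : G `<=` cover setT U.
  move=> x /GS [k _ Skx]; exists k => //; exists x => //=.
  by rewrite edistxx.
have [|L _ GL] := compact_cover_plane cG _ GU.
  by move=> k _; exact: open_thickening.
pose dm k : R := fine (ediam (S k)).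
have dmE k : ediam (S k) = (dm k)%:E.
  rewrite fineK// fin_numElt (lt_le_trans _ (ediam_ge0 _)) ?ltNyr//=.
  by rewrite (le_lt_trans (Sd k)) ?ltry.
have dm0 k : 0 <= dm k by rewrite -lee_fin -dmE ediam_ge0.
have dmd k : dm k <= delta by rewrite -lee_fin -dmE.
pose w k := dm k + 2 * eta k.
pose LL : seq nat := finmap.enum_fset L.
pose C k : set (R * R) := [set x | [/\ k \in LL, U k x & G x]].
have sumw : \sum_(k <- LL) w k <= h + 2 * delta.
  have s1 : \sum_(k <- LL) dm k <= h + delta.
    rewrite -lee_fin (le_trans _ (ltW Sh))// -sumEFin.
    under eq_bigr do rewrite -dmE.
    exact: (@lee_sum_fset_lim R _ L xpredT (fun i _ => ediam_ge0 _)).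
  have s2 : \sum_(k <- LL) eta k <= delta / 2.
    rewrite -lee_fin -sumEFin.
    rewrite (le_trans (@lee_sum_fset_lim R (fun k => (eta k)%:E) L xpredT _))//.
      by move=> i _; rewrite lee_fin ltW.
    by apply: epsilon_trick0; rewrite divr_ge0 ?ltW.
  by rewrite /w big_split/= -mulr_sumr; lra.
have Cw k y z : C k y -> C k z -> edist y z <= w k.
  move=> [_ [a Sa ay] _] [_ [b Sb bz] _].
  have ab : edist a b <= dm k by rewrite -lee_fin -dmE le_ediam.
  move: ay bz => /= ay bz.
  have := edist_triangle a y z; have := edist_triangle b a z.
  by rewrite (edistC y a) /w; lra.
have w0 k : 0 <= w k by rewrite addr_ge0// mulr_ge0// ltW.
have wd k : w k <= 2 * delta.
  by rewrite /w; have := dmd k; have := etad k; lra.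
have GLL x : G x -> exists k, C k x.
  by move=> Gx; have [k kL Ukx] := GL _ Gx; exists k.
have same D i j x y : saturated C D -> connected_component G x y ->
    C i x -> C j y -> D i = D j.
  move=> sD xy Ci Cj.
  apply: (@saturated_component R nat [set k | k \in LL] U G C D i j x y) => //.
  by move=> k _; exact: open_thickening.
pose loc (j : J) : nat := xget 0%N [set k | C k (pos j)].
have locP j : j \in js -> C (loc j) (pos j).
  by move=> /Gjs /GLL [k Ck]; rewrite /loc; case: xgetP => // /(_ k).
pose root k := k \in [seq loc j | j <- js].
pose LL' := [seq k <- LL | `[< C k !=set0 >]].
have [||l fl lL] := @forest_order_exists R nat C root LL'.
- move=> k Ck; rewrite mem_filter; apply/andP; split; first exact/asboolP.
  by case: Ck => x [].
- move=> D sD k; rewrite mem_filter => /andP[/asboolP[x Ckx] _] Dk.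
  have Gx : G x by case: Ckx.
  have [j jj xj] := redG _ Gx.
  have Cj := locP _ jj.
  exists (loc j); split.
  + rewrite mem_filter; apply/andP; split; last by case: Cj.
    by apply/asboolP; exists (pos j).
  + by rewrite -(same _ _ _ _ _ sD xj Ckx Cj).
  + by apply/mapP; exists j.
have suml : \sum_(k <- l) w k <= h + 2 * delta.
  rewrite (perm_big LL'); last first.
    apply: uniq_perm => //; first exact: forest_order_uniq fl.
    by rewrite filter_uniq// finmap.fset_uniq.
  apply: le_trans sumw; rewrite big_filter big_mkcond ler_sum// => k _.
  by case: ifP.
have [|||||prs [pprs len mk]] := @forest_pairing R nat J C w (2 * delta) pos root
    Cw w0 wd _ (size l + size js)%N l l js loc (fun=> 0) (leqnn _) fl
    (or_introl erefl) ujs.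
- by rewrite mulr_ge0// ltW.
- by move=> k _ /mapP[j jj ->]; exists j.
- move=> j jj; have Cj := locP _ jj; rewrite lL mem_filter.
  apply/andP; split; last by case: Cj.
  by apply/asboolP; exists (pos j).
- by move=> j jj; exists (pos j); [exact: locP|rewrite edistxx].
- move=> D sD.
  apply: (@odd_count_classes J
    (fun i j => `[< connected_component G (pos i) (pos j) >])) => //.
  + by move=> i j; apply/asboolP/asboolP => /connected_component_sym.
  + move=> j i k /asboolP ij /asboolP jk; apply/asboolP.
    exact: connected_component_trans ij jk.
  + by move=> j jj; apply/asboolP/connected_component_refl/Gjs.
  + move=> i j ii jj /asboolP ij.
    exact: same sD ij (locP _ ii) (locP _ jj).
have s0 : \sum_(j <- js) (0 : R) = 0 by rewrite big1.
rewrite s0 add0r in len.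
exists prs; split=> //.
  by rewrite mulrDl; lra.
move=> z Gz; have [k Ck] := GLL _ Gz.
have [|e ee le] := mk z (2 * delta).
  left; exists k, z; split=> //; last by rewrite edistxx add0r.
  rewrite lL mem_filter; apply/andP; split; last by case: Ck.
  by apply/asboolP; exists z.
by exists e => //; rewrite s0 add0r in le; lra.
Qed.

(** * Passage to the limit *)

Lemma finite_pigeonhole (R : realFieldType) (T : finType)
    (P : R -> T -> Prop) :
  (forall e e' t, e <= e' -> P e t -> P e' t) ->
  (forall e, 0 < e -> exists t, P e t) ->
  exists t, forall e, 0 < e -> P e t.
Proof.
move=> Pmono Pex; apply: contrapT => noT.
have fail (s : seq T) : exists2 e, 0 < e & forall t, t \in s -> ~ P e t.
  elim: s => [|t s [e e0 IH]]; first by exists 1.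
  have [e' [e'0 nP]] : exists e', 0 < e' /\ ~ P e' t.
    apply: contrapT => no; apply: noT; exists t => e' e'0.
    by apply: contrapT => nP; apply: no; exists e'.
  exists (Num.min e e'); first by rewrite lt_min e0.
  move=> x; rewrite inE => /orP[/eqP->|xs] Px.
    by apply: nP; apply: Pmono Px; rewrite ge_min lexx orbT.
  by apply: (IH _ xs); apply: Pmono Px; rewrite ge_min lexx.
have [e e0 nP] := fail (enum T).
have [t Pt] := Pex e e0.
by apply: nP Pt; rewrite mem_enum.
Qed.

(** The matching given by [cover_pairing] depends on the mesh, but it ranges over
    a finite set, and so does the pair whose detour is bounded; one value of
    each serves for all meshes. *)
Lemma limit_pairing (R : realType) (J : finType) (pos : J -> R * R)
    (G : set (R * R)) (h : R) :
  compact G -> (forall j, G (pos j)) ->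
  (forall j, ~~ odd (count
     (fun k => `[< connected_component G (pos j) (pos k) >]) (enum J))) ->
  (forall x, G x -> exists j, connected_component G x (pos j)) ->
  (hausdorff1 G <= h%:E)%E ->
  exists prs : seq (J * J),
    [/\ perm_eq (unzip1 prs ++ unzip2 prs) (enum J),
        pairs_length pos prs <= h &
        forall z, G z -> exists2 e, e \in prs &
          pairs_length pos prs + detour (pos e.1) (pos e.2) z / 2 <= h].
Proof.
move=> cG Gpos ev redG Gh.
pose K : R := 2 * (size (enum J))%:R + 4.
have K0 : 0 < K by rewrite ltr_wpDl// mulr_ge0.
have small (a : R) : (forall e, 0 < e -> a <= h + K * e) -> a <= h.
  move=> ale; apply/ler_addgt0Pr => e e0.
  by have := ale (e / K); rewrite divr_gt0// mulrC divfK ?gt_eqF//; apply.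
have Kmono (a e e' : R) : e <= e' -> a <= h + K * e -> a <= h + K * e'.
  by move=> ee' /le_trans; apply; rewrite lerD2l ler_pM2l.
pose P e (t : #|J|./2.-tuple (J * J)) :=
  [/\ perm_eq (unzip1 t ++ unzip2 t) (enum J),
      pairs_length pos t <= h + K * e &
      forall z, G z -> exists2 u, u \in (t : seq _) &
        pairs_length pos t + detour (pos u.1) (pos u.2) z / 2 <= h + K * e].
have [||t Pt] := @finite_pigeonhole R _ P.
- move=> e e' t ee' [tJ tlen tz]; split=> // [|z Gz]; first exact: Kmono tlen.
  by have [u ut le] := tz _ Gz; exists u => //; exact: Kmono le.
- move=> e e0.
  have [||||prs [pJ plen pz]] :=
    @cover_pairing R J pos (enum J) G h e (enum_uniq _) cG e0 _ _ _ (le_trans _ Gh).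
  + by [].
  + by [].
  + by move=> x /redG [j xj]; exists j => //; rewrite mem_enum.
  + by apply: ereal_sup_ubound; exists e.
  have szp : size prs == #|J|./2.
    by rewrite cardE -(perm_size pJ) size_cat !size_map addnn doubleK.
  by exists (Tuple szp).
have [tJ _ _] := Pt 1 ltr01.
exists t; split=> //; first by apply: small => e /Pt[].
move=> z Gz.
have [||u uP] := @finite_pigeonhole R (J * J)%type (fun e u => u \in (t : seq _) /\
  pairs_length pos t + detour (pos u.1) (pos u.2) z / 2 <= h + K * e).
- by move=> e e' u ee' [ut le]; split=> //; exact: Kmono le.
- by move=> e /Pt [_ _ /(_ z Gz) [u ut le]]; exists u.
exists u; first by have [] := uP 1 ltr01.
by apply: small => e /uP [].
Qed.

(** * Support of an atomic measure *)

(** The support is tested on open sets, whereas the atomic form of the measure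
    is given on measurable sets. An open set is the union of the rational boxes
    that it contains. *)
Lemma open_measurable_plane (R : realType) (U : set (R * R)) :
  open U -> measurable U.
Proof.
move=> Uo.
pose box (i : (rat * rat) * (rat * rat)) : set (R * R) :=
  `]ratr i.1.1, ratr i.1.2[ `*` `]ratr i.2.1, ratr i.2.2[.
pose F i : set (R * R) := if `[< box i `<=` U >] then box i else set0.
have -> : U = \bigcup_i F i.
  apply/seteqP; split=> [[x y] Uxy|z [i _]]; last first.
    by rewrite /F; case: ifP => // /asboolP + /=; apply.
  have /nbhs_ballP[e /= e0 eU] : nbhs (x, y) U by exact: open_nbhs_nbhs.
  have q (t : R) : exists a b : rat,
      t - e < ratr a < t /\ t < ratr b < t + e.
    have [|a ta] := @rat_in_itvoo R (t - e) t; first by rewrite gtrBl.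
    have [|b tb] := @rat_in_itvoo R t (t + e); first by rewrite ltrDl.
    by exists a, b; move: ta tb; rewrite !in_itv.
  have [a [b [xa xb]]] := q x; have [c [f [yc yf]]] := q y.
  move: xa xb yc yf => /andP[a1 a2] /andP[b1 b2] /andP[c1 c2] /andP[f1 f2].
  exists ((a, b), (c, f)) => //; rewrite /F asboolT.
    by split; rewrite /= in_itv/=; apply/andP.
  move=> [u v] [] /=; rewrite !in_itv/= => /andP[u1 u2] /andP[v1 v2].
  apply: eU; split => /=; rewrite /ball/= ltr_norml; apply/andP; split; lra.
apply: countable_bigcupT_measurable => [|i]; first exact: countableP.
rewrite /F; case: ifP => // _.
by apply: measurableX; exact: measurable_itv.
Qed.

Lemma spt_atomic (R : realType) (n : nat) (x : 'I_n -> R * R)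
    (mu : {measure set (R * R) -> \bar R}) :
  (forall B, measurable B ->
     mu B = ((2 * pi)%:E * \sum_(k < n) \d_(x k) B)%E) ->
  spt mu = range x.
Proof.
move=> muE; have pi0 : 0 < 2 * pi :> R by rewrite mulr_gt0// pi_gt0.
apply/seteqP; split=> [z zs|_ [k _ <-] U Uo Ux].
  apply: contrapT => nz.
  have Co : open (~` range x).
    apply: closed_openC; apply: compact_closed; first exact: norm_hausdorff.
    by apply: finite_compact; exact: finite_image.
  have := zs _ Co nz; rewrite muE; last exact: open_measurable_plane.
  rewrite big1 ?mule0 ?ltxx// => k _.
  by rewrite diracE memNset// => -[]; exists k.
rewrite muE; last exact: open_measurable_plane.
rewrite mule_gt0// (bigD1 k)//= diracE mem_set//.
by rewrite (@lt_le_trans _ _ 1%E)// leeDl// sume_ge0.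
Qed.

Lemma card_seq (T : eqType) (s : seq T) : uniq s -> ([set` s] #= `I_(size s))%card.
Proof.
elim: s => [_|x s IHs /= /andP[xs us]].
  suff -> : [set` [::]] = set0 :> set T by rewrite II0 card_eq0.
  by apply/seteqP; split.
apply/eq_cardSP; exists x; first by rewrite /= inE eqxx.
suff -> : [set` x :: s] `\ x = [set` s] by exact: IHs.
apply/seteqP; split=> y /=.
  by rewrite inE => -[/orP[/eqP|]].
move=> ys; rewrite inE ys orbT; split=> // yx.
by rewrite yx (negbTE xs) in ys.
Qed.

Lemma card_preim (T : eqType) (J : finType) (pos : J -> T) (K : set T) :
  injective pos ->
  (K `&` range pos #= `I_(count (fun j => `[< K (pos j) >]) (enum J)))%card.
Proof.
move=> inj.
set s := [seq pos j | j <- [seq j <- enum J | `[< K (pos j) >]]].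
have -> : K `&` range pos = [set` s].
  apply/seteqP; split=> [y [+ [j _ jy]]|y /mapP[j]] /=.
    rewrite -jy => Kj; apply: map_f; rewrite mem_filter mem_enum andbT.
    exact/asboolP.
  by rewrite mem_filter => /andP[/asboolP Kj _] ->; split=> //; exists j.
rewrite -size_filter -(size_map pos); apply: card_seq.
by rewrite map_inj_uniq// filter_uniq// enum_uniq.
Qed.

(** * Unions of segments as competitors *)

Definition segments (R : realType) (J : eqType) (pos : J -> R * R)
    (prs : seq (J * J)) : set (R * R) :=
  \bigcup_(e in [set` prs]) segment (pos e.1) (pos e.2).

Lemma continuous_segment (R : realType) (x y : R * R) :
  continuous (fun t : R => (1 - t) *: x + t *: y).
Proof.
by move=> t; apply: cvgD; apply: cvgZ; try exact: cvg_cst;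
  [apply: cvgB; [exact: cvg_cst|exact: cvg_id]|exact: cvg_id].
Qed.

Lemma compact_segment (R : realType) (x y : R * R) : compact (segment x y).
Proof.
apply: continuous_compact; last exact: segment_compact.
by apply: continuous_subspaceT; exact: continuous_segment.
Qed.

Lemma connected_segment (R : realType) (x y : R * R) : connected (segment x y).
Proof.
apply: connected_continuous_connected; first exact: segment_connected.
by apply: continuous_subspaceT; exact: continuous_segment.
Qed.

Lemma nneseries_nth (R : realType) (l : seq (set (R * R))) :
  (\sum_(0 <= k <oo) ediam (nth set0 l k) <= \sum_(A <- l) ediam A)%E.
Proof.
apply: lime_le.
  by apply: is_cvg_nneseries => k _ _; exact: ediam_ge0.
apply: nearW => n; elim: n l => [|n IHn] [|A l].
- by rewrite big_geq// big_nil.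
- by rewrite big_geq// sume_ge0// => B _; exact: ediam_ge0.
- rewrite big1 ?big_nil// => k _; rewrite nth_nil.
  by apply/eqP; rewrite eq_le ediam_ge0 andbT ediam_le.
- by rewrite big_nat_recl//= big_cons leeD2l.
Qed.

(** Cutting each segment into [N] equal pieces gives covers of arbitrarily
    small mesh with the same total diameter. *)
Lemma hausdorff1_segments (R : realType) (J : eqType) (pos : J -> R * R)
    (prs : seq (J * J)) :
  (hausdorff1 (segments pos prs) <= (pairs_length pos prs)%:E)%E.
Proof.
apply: ge_ereal_sup => _ [delta /= d0 <-].
pose len (e : J * J) := edist (pos e.1) (pos e.2).
pose N := (Num.truncn (pairs_length pos prs / delta)).+1.
have N0 : 0 < N%:R :> R by rewrite ltr0n.
have lenN e : e \in prs -> len e / N%:R <= delta.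
  move=> ee; rewrite ler_pdivrMr// mulrC -ler_pdivrMr//.
  have /ltW/(le_trans _) := truncnS_gt (pairs_length pos prs / delta).
  apply; rewrite ler_pM2r ?invr_gt0// /pairs_length (big_rem e)//= lerDl.
  by rewrite sumr_ge0// => ? _; exact: edist_ge0.
pose piece (e : J * J) (i : nat) : set (R * R) :=
  [set (1 - t) *: pos e.1 + t *: pos e.2 |
     t in `[i%:R / N%:R, i.+1%:R / N%:R]%classic].
have dpiece e i : (ediam (piece e i) <= (len e / N%:R)%:E)%E.
  apply: ediam_le; first by rewrite divr_ge0 ?edist_ge0.
  move=> _ _ [s + <-] [t + <-]; rewrite /= !in_itv/= edist_segment => st tt.
  rewrite mulrC ler_wpM2l ?edist_ge0//.
  have Si : i.+1%:R / N%:R = i%:R / N%:R + N%:R^-1 :> R.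
    by rewrite -natr1 mulrDl mul1r.
  move: st tt; rewrite Si => /andP[s1 s2] /andP[t1 t2].
  by rewrite ler_norml; apply/andP; split; lra.
pose l := [seq piece e i | e <- prs, i <- iota 0 N].
apply: (@le_trans _ _ (\sum_(0 <= k <oo) ediam (nth set0 l k))%E); last first.
  apply: le_trans (nneseries_nth l) _.
  rewrite big_allpairs_dep/= /pairs_length -sumEFin.
  apply: lee_sum => e _.
  apply: (@le_trans _ _ (\sum_(i <- iota 0 N) (len e / N%:R)%:E)%E).
    by apply: lee_sum => i _; exact: dpiece.
  rewrite sumEFin big_const_seq count_predT size_iota iter_addr_0 lee_fin.
  by rewrite -[_ *+ N]mulr_natr -mulrA mulVf ?mulr1// gt_eqF.
apply: ereal_inf_lbound; exists (fun k => nth set0 l k) => //; split.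
  move=> z [e /= ee [t + tz]]; rewrite /= in_itv/= => /andP[t0 t1].
  (* The minimum with [N.-1] puts the endpoint [t = 1] in the last piece. *)
  pose i := minn (Num.truncn (t * N%:R)) N.-1.
  have zp : piece e i z.
    exists t => //; rewrite /= in_itv/= ler_pdivrMr// ler_pdivlMr//.
    have tN0 : 0 <= t * N%:R by rewrite mulr_ge0.
    have /andP[i1 i2] := truncn_itv tN0.
    have tN1 : t * N%:R <= N%:R by rewrite ler_piMl.
    have [tN|Nt] := ltnP (Num.truncn (t * N%:R)) N.
      rewrite /i; have /minn_idPl -> : (Num.truncn (t * N%:R) <= N.-1)%N by [].
      by rewrite i1 ltW.
    rewrite /i; have /minn_idPr -> : (N.-1 <= Num.truncn (t * N%:R))%N.
      exact: leq_trans (leq_pred _) Nt.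
    rewrite tN1 andbT (le_trans _ i1)// ler_nat.
    exact: leq_trans (leq_pred _) Nt.
  have /(nthP set0)[k kl kz] : piece e i \in l.
    apply/allpairsPdep; exists e, i; split=> //.
    by rewrite mem_iota/= add0n /i ltnS geq_minr.
  by exists k => //; rewrite kz.
move=> k; have [kl|kl] := ltnP k (size l); last first.
  by rewrite nth_default// ediam_le// ltW.
have /allpairsPdep[e [i [ee _ ->]]] := mem_nth set0 kl.
by rewrite (le_trans (dpiece _ _))// lee_fin lenN.
Qed.

(** Every segment is connected, so a component of the union contains both ends
    of a pair or neither. *)
Lemma segments_admissible (R : realType) (J : finType) (pos : J -> R * R)
    (prs : seq (J * J)) (mu : {measure set (R * R) -> \bar R}) :
  injective pos -> spt mu = range pos ->
  perm_eq (unzip1 prs ++ unzip2 prs) (enum J) ->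
  Lambda_admissible 2 mu (segments pos prs).
Proof.
move=> inj sptE pJ; split.
- rewrite /segments bigcup_seq; apply: bigsetU_compact => e _.
  exact: compact_segment.
- rewrite sptE => _ [j _ <-].
  have : j \in unzip1 prs ++ unzip2 prs by rewrite (perm_mem pJ) mem_enum.
  rewrite mem_cat => /orP[] /mapP[e ee ->]; exists e => //.
    exact: segment_left.
  exact: segment_right.
move=> z Gz; set K := connected_component _ z.
exists (count (fun e : J * J => `[< K (pos e.1) >]) prs).
rewrite sptE; have := card_preim K inj.
rewrite -(seq.permP pJ) count_cat !count_map mul2n -addnn.
rewrite (@eq_in_count _ (preim snd _)
  (fun e : J * J => `[< K (pos e.1) >])) // => e ee /=.
have seg a b : segment (pos e.1) (pos e.2) a -> segment (pos e.1) (pos e.2) b ->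
    K a -> K b.
  move=> ea eb Ka; apply: connected_component_trans Ka _.
  apply: (connected_component_max ea) eb; last exact: connected_segment.
  by move=> y ey; exists e.
have el := segment_left (pos e.1) (pos e.2).
have er := segment_right (pos e.1) (pos e.2).
by apply/asboolP/asboolP; apply: seg.
Qed.

Lemma minimizer_le (R : realType) (J : finType) (pos : J -> R * R)
    (prs : seq (J * J)) (mu : {measure set (R * R) -> \bar R})
    (G : set (R * R)) :
  injective pos -> spt mu = range pos -> Lambda_minimizer 2 mu G ->
  perm_eq (unzip1 prs ++ unzip2 prs) (enum J) ->
  (hausdorff1 G <= (pairs_length pos prs)%:E)%E.
Proof.
move=> inj sptE [_ Gmin] /(segments_admissible inj sptE)/Gmin/le_trans; apply.
exact: hausdorff1_segments.
Qed.

(** * Minimal matchings and the structure of minimizers *)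

(** Both exchanges of partners between two of the pairs give perfect matchings,
    so [uncross] applies. *)
Lemma minimal_disjoint (R : realType) (J : eqType) (pos : J -> R * R)
    (prs : seq (J * J)) :
  injective pos -> uniq (unzip1 prs ++ unzip2 prs) ->
  (forall prs', perm_eq (unzip1 prs' ++ unzip2 prs')
                        (unzip1 prs ++ unzip2 prs) ->
     pairs_length pos prs <= pairs_length pos prs') ->
  {in prs &, forall e f, e != f ->
    segment (pos e.1) (pos e.2) `&` segment (pos f.1) (pos f.2) = set0}.
Proof.
move=> inj un pmin e f ee ff ef.
have uprs : uniq prs by move: un; rewrite cat_uniq => /andP[/map_uniq].
have pp : perm_eq prs [:: e, f & rem f (rem e prs)].
  rewrite (permPl (perm_to_rem ee)) perm_cons perm_to_rem//.
  by rewrite mem_rem_uniq// inE ff andbT eq_sym.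
set rest := rem f _ in pp.
have cnt a : count a (unzip1 prs ++ unzip2 prs) =
    (a e.1 + a e.2 + (a f.1 + a f.2) + count a (unzip1 rest ++ unzip2 rest))%N.
  rewrite /unzip1 /unzip2 !count_cat.
  rewrite (seq.permP (perm_map fst pp)) (seq.permP (perm_map snd pp))/=; lia.
have lenE : pairs_length pos prs = edist (pos e.1) (pos e.2) +
    (edist (pos f.1) (pos f.2) + pairs_length pos rest).
  by rewrite /pairs_length (perm_big _ pp)/= !big_cons.
apply: uncross.
- have : uniq [:: e.1; e.2; f.1; f.2].
    have : perm_eq (unzip1 prs ++ unzip2 prs)
        ([:: e.1; e.2; f.1; f.2] ++ (unzip1 rest ++ unzip2 rest)).
      by apply/seq.permP => a; rewrite cnt !count_cat /=; lia.
    by move=> /perm_uniq; rewrite un cat_uniq => /esym/andP[].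
  by rewrite -(map_inj_uniq inj).
- have := pmin [:: (e.1, f.1), (e.2, f.2) & rest].
  rewrite {1}lenE /pairs_length !big_cons/= => exch.
  suff /exch : perm_eq (unzip1 [:: (e.1, f.1), (e.2, f.2) & rest] ++
      unzip2 [:: (e.1, f.1), (e.2, f.2) & rest]) (unzip1 prs ++ unzip2 prs) by lra.
  by apply/seq.permP => a; rewrite cnt /= !count_cat /=; lia.
- have := pmin [:: (e.1, f.2), (e.2, f.1) & rest].
  rewrite {1}lenE /pairs_length !big_cons/= => exch.
  suff /exch : perm_eq (unzip1 [:: (e.1, f.2), (e.2, f.1) & rest] ++
      unzip2 [:: (e.1, f.2), (e.2, f.1) & rest]) (unzip1 prs ++ unzip2 prs) by lra.
  by apply/seq.permP => a; rewrite cnt /= !count_cat /=; lia.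
Qed.

(** The distance to [p] takes all intermediate values on [K], and it separates
    the points of the segment. *)
Lemma connected_sub_segment (R : realType) (K : set (R * R)) (p q : R * R) :
  connected K -> K p -> K q -> K `<=` segment p q -> segment p q `<=` K.
Proof.
move=> Kc Kp Kq Ks z zs.
have /connected_intervalP Ki : connected [set edist p y | y in K].
  apply: connected_continuous_connected => //.
  by apply: continuous_subspaceT; exact: continuous_edist.
have [|||y Ky yz] := Ki (edist p p) (edist p q) _ _ (edist p z).
- by exists p.
- by exists q.
- by rewrite edistxx edist_ge0/= -(segment_edist zs) lerDl edist_ge0.
suff -> : z = y by [].
case: zs yz => t + <-; have [s + <-] := Ks _ Ky.
rewrite /= !in_itv/= => /andP[s0 _] /andP[t0 _].
have := edist_segment p q 0 s; have := edist_segment p q 0 t.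
rewrite subr0 scale1r scale0r addr0 => -> ->.
rewrite !sub0r !normrN !ger0_norm// => st.
have [/edist_eq0 <-|pq] := eqVneq (edist p q) 0.
  by rewrite -!scalerDl !subrK.
by rewrite (mulIf pq st).
Qed.

(** The segment that contains [x] is relatively clopen in the union: the others
    are finitely many compact sets that miss it. *)
Lemma connected_sub_segments (R : realType) (J : choiceType) (pos : J -> R * R)
    (prs : seq (J * J)) (K : set (R * R)) (e : J * J) (x : R * R) :
  {in prs &, forall e f, e != f ->
    segment (pos e.1) (pos e.2) `&` segment (pos f.1) (pos f.2) = set0} ->
  connected K -> K `<=` segments pos prs -> e \in prs -> K x ->
  segment (pos e.1) (pos e.2) x -> K `<=` segment (pos e.1) (pos e.2).
Proof.
move=> dis Kc Ks ee Kx ex.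
have Sclosed (f : J * J) : closed (segment (pos f.1) (pos f.2)).
  by apply: compact_closed; [exact: norm_hausdorff|exact: compact_segment].
have KE : K `&` segment (pos e.1) (pos e.2) = K.
  apply: Kc.
  - by exists x.
  - exists (~` \bigcup_(f in [set f | f \in [seq f <- prs | f != e]])
        segment (pos f.1) (pos f.2)).
      apply: closed_openC; apply: closed_bigcup => [|f _]; last exact: Sclosed.
      exact: finite_seq.
    apply/seteqP; split=> z [Kz].
      move=> ez; split=> // -[f] /=; rewrite mem_filter => /andP[fe ff] fz.
      by have := dis _ _ ff ee fe; apply/eqP/set0P; exists z.
    move=> nz; split=> //; have [f /= ff fz] := Ks _ Kz.
    have [<-//|fe] := eqVneq f e.
    by case: nz; exists f => //=; rewrite mem_filter fe.
  - by exists (segment (pos e.1) (pos e.2)).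
by rewrite -KE => z [].
Qed.

Lemma hausdorff1_ge0 (R : realType) (A : set (R * R)) : (0 <= hausdorff1 A)%E.
Proof.
apply: (@le_trans _ _ (hausdorff1_pre 1 A)).
  apply: le_ereal_inf_tmp => _ [C _ <-].
  by apply: nneseries_ge0 => k _ _; exact: ediam_ge0.
by apply: ereal_sup_ubound; exists 1 => //=.
Qed.

Lemma count_sum (T : Type) (P : pred T) (s : seq T) :
  count P s = (\sum_(i <- s) P i)%N.
Proof. by elim: s => [|i s IHs]; rewrite ?big_nil// big_cons /= IHs. Qed.

Lemma pairing_exists (J : finType) (d : nat) : #|J| = (2 * d)%N ->
  exists prs : seq (J * J), perm_eq (unzip1 prs ++ unzip2 prs) (enum J).
Proof.
rewrite cardE => cJ; exists (zip (take d (enum J)) (drop d (enum J))).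
have tE : size (take d (enum J)) = d by rewrite size_takel// cJ mul2n -addnn leq_addr.
have dE : size (drop d (enum J)) = d by rewrite size_drop cJ mul2n -addnn addnK.
by rewrite unzip1_zip ?unzip2_zip ?cat_take_drop ?tE ?dE.
Qed.

Theorem proposition4p7 (R : realType) (d : nat) (Omega : set (R * R))
    (Omega_open : open Omega) (Omega_bounded : bounded_set Omega)
    (Omega_convex : convex_set Omega) (Omega_smooth : smooth_domain Omega)
    (mu : {measure set (R * R) -> \bar R})
    (mu_Ad : atomic_measures 2 d Omega mu)
    (Gamma : set (R * R)) (Gamma_min : Lambda_minimizer 2 mu Gamma)
    (Gamma_reduced : reduced mu Gamma) :
  exists S : 'I_d -> set (R * R),
    [/\ (forall k, exists a b, S k = segment a b),
        trivIset setT S,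
        Gamma = \bigcup_k S k &
        forall k, exists p q, p <> q /\ S k `&` spt mu = [set p; q]] /\
    forall p q : 'I_d -> R * R,
      (forall k, S k `&` spt mu = [set p k; q k]) ->
      (forall k, S k = segment (p k) (q k)) /\
      hausdorff1 Gamma = (minimal_connection p q)%:E.
Proof.
have [x [xinj _ muE]] := mu_Ad.
have sptE := spt_atomic muE.
have [[Gc sptG Gev] _] := Gamma_min.
set J := 'I_(2 * d) in x xinj muE sptE.
have xspt j : spt mu (x j) by rewrite sptE; exists j.
have Gx j : Gamma (x j) by exact: sptG.
have compev z : Gamma z ->
    ~~ odd (count (fun k => `[< connected_component Gamma z (x k) >]) (enum J)).
  move=> /Gev[n]; rewrite sptE => Kn.
  have /card_eq_II -> := card_eq_trans (card_esym (card_preim _ xinj)) Kn.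
  by rewrite mul2n odd_double.
have [prs0 prs0J] := @pairing_exists J d (card_ord _).
have hE : hausdorff1 Gamma = (fine (hausdorff1 Gamma))%:E.
  rewrite fineK// ge0_fin_numE ?hausdorff1_ge0//.
  exact: le_lt_trans (minimizer_le xinj sptE Gamma_min prs0J) (ltry _).
set h := fine _ in hE.
have hle prs : perm_eq (unzip1 prs ++ unzip2 prs) (enum J) -> h <= pairs_length x prs.
  by move=> /(minimizer_le xinj sptE Gamma_min); rewrite hE lee_fin.
have [|||prs [prsJ lenh near]] := @limit_pairing R J x Gamma h Gc Gx.
- by move=> j; exact: compev.
- move=> z /Gamma_reduced[y [zy]]; rewrite sptE => -[j _ jy].
  by exists j; rewrite jy.
- by rewrite hE.
have lenE : pairs_length x prs = h by apply/eqP; rewrite eq_le lenh hle.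
(* The detour bound leaves no slack, so every point of [Gamma] lies on a segment. *)
have GS : Gamma `<=` segments x prs.
  move=> z /near[e ee]; rewrite lenE /detour => le0; exists e => //.
  by apply: edist_between; lra.
have uprs : uniq (unzip1 prs ++ unzip2 prs) by rewrite (perm_uniq prsJ) enum_uniq.
have dis := minimal_disjoint xinj uprs.
have {}dis : {in prs &, forall e f, e != f ->
    segment (x e.1) (x e.2) `&` segment (x f.1) (x f.2) = set0}.
  apply: dis => prs' /perm_trans/(_ prsJ)/hle; by rewrite lenE.
have e12 e : e \in prs -> e.1 != e.2.
  move=> ee; move: uprs; rewrite cat_uniq => /and3P[_ /hasPn no _].
  have := no e.2 (map_f _ ee); apply: contraNneq => <-; exact: map_f.
have segspt e : e \in prs ->
    segment (x e.1) (x e.2) `&` spt mu = [set x e.1; x e.2].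
  move=> ee; apply/seteqP; split=> z; last first.
    by case=> ->; split=> //; [exact: segment_left|exact: segment_right].
  rewrite sptE => -[ez [j _ jz]].
  have : j \in unzip1 prs ++ unzip2 prs by rewrite (perm_mem prsJ) mem_enum.
  rewrite mem_cat => jprs.
  have [f [ff fj]] : exists f, f \in prs /\ (j = f.1 \/ j = f.2).
    by case/orP: jprs => /mapP[f ff ->]; exists f; split=> //; [left|right].
  have fz : segment (x f.1) (x f.2) z.
    by rewrite -jz; case: fj => ->; [exact: segment_left|exact: segment_right].
  have [<-|ef] := eqVneq f e.
    by rewrite -jz; case: fj => ->; [left|right].
  by have := dis _ _ ff ee ef; move/seteqP => [/(_ z)[]].
have SG e : e \in prs -> segment (x e.1) (x e.2) `<=` Gamma.
  move=> ee; set K := connected_component Gamma (x e.1).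
  have Ke1 : K (x e.1) by exact: connected_component_refl.
  have KG : K `<=` Gamma by exact: connected_component_sub.
  have Kc : connected K by exact: component_connected.
  have Ks : K `<=` segment (x e.1) (x e.2).
    apply: (connected_sub_segments dis Kc) ee Ke1 (segment_left _ _).
    exact: subset_trans KG GS.
  have Ke2 : K (x e.2).
    (* Otherwise [K] contains a single point of the support, an odd number. *)
    apply: contrapT => nK; have := compev _ (Gx e.1); rewrite -/K.
    rewrite (@eq_count _ _ (pred1 e.1)) ?count_uniq_mem ?enum_uniq ?mem_enum//.
    move=> j /=; apply/asboolP/eqP => [Kj|-> //].
    have : (segment (x e.1) (x e.2) `&` spt mu) (x j) by split=> //; exact: Ks.
    by rewrite segspt// => -[/xinj//|je]; case: nK; rewrite -je.
  exact: subset_trans (connected_sub_segment Kc Ke1 Ke2 Ks) KG.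
have szp : size prs == d.
  rewrite -(eqn_pmul2l (isT : 0 < 2)%N) -[X in _ == X](card_ord (2 * d)) cardE.
  by rewrite -(perm_size prsJ) size_cat !size_map mul2n addnn.
pose t := Tuple szp.
have tprs k : tnth t k \in prs by exact: mem_tnth.
have tinj : injective (tnth t).
  by apply/tuple_uniqP; move: uprs; rewrite cat_uniq => /andP[/map_uniq].
have tdis j k : j != k -> tnth t j != tnth t k by rewrite (inj_eq tinj).
exists (fun k => segment (x (tnth t k).1) (x (tnth t k).2)); split.
  split.
  - by move=> k; exists (x (tnth t k).1), (x (tnth t k).2).
  - move=> j k _ _ jk; apply: contrapT => /eqP/tdis njk.
    by move: jk; rewrite dis//; case.
  - apply/seteqP; split=> z; last by move=> [k _]; exact: SG.
    move=> /GS[e /= ee ez]; have /tnthP[k ek] : e \in t by [].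
    by exists k => //; rewrite -ek.
  - move=> k; exists (x (tnth t k).1), (x (tnth t k).2); split.
      by move=> /xinj; apply/eqP/e12.
    exact: segspt.
move=> p q pqS.
(* [p k] and [q k] may label the two ends of the segment in either order. *)
pose a k := if p k == x (tnth t k).1 then (tnth t k).1 else (tnth t k).2.
pose b k := if p k == x (tnth t k).1 then (tnth t k).2 else (tnth t k).1.
have pq k : p k = x (a k) /\ q k = x (b k).
  have pqk : [set p k; q k] = [set x (tnth t k).1; x (tnth t k).2].
    by rewrite -segspt.
  have ne : x (tnth t k).1 <> x (tnth t k).2 by move=> /xinj; apply/eqP/e12.
  rewrite /a /b; set u := x (tnth t k).1 in pqk ne *.
  set v := x (tnth t k).2 in pqk ne *.
  have pp : [set u; v] (p k) by rewrite -pqk; left.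
  have qq : [set u; v] (q k) by rewrite -pqk; right.
  have uu : [set p k; q k] u by rewrite pqk; left.
  have vv : [set p k; q k] v by rewrite pqk; right.
  case: eqP => [pu|pu].
    split=> //; case: vv => // vp.
    by case: ne; rewrite vp pu.
  have pv : p k = v by case: pp.
  by split=> //; case: uu => // up; case: pu.
have segab k : segment (x (tnth t k).1) (x (tnth t k).2) =
    segment (x (a k)) (x (b k)).
  by rewrite /a /b; case: ifP => // _; rewrite segmentC.
split=> [k|]; first by have [-> ->] := pq k.
have lenab : connection_length p q 1%g = h.
  rewrite -lenE /pairs_length (_ : prs = t)// big_tuple.
  apply: eq_bigr => k _; rewrite perm1; have [-> ->] := pq k.
  by rewrite /a /b; case: ifP => // _; rewrite edistC.
rewrite hE; congr EFin; apply/eqP; rewrite eq_le; apply/andP; split; last first.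
  by rewrite -lenab; exact: bigmin_le_id.
have hs (s : {perm 'I_d}) : h <= connection_length p q s.
  have := hle [seq (a k, b (s k)) | k <- index_enum 'I_d].
  rewrite /pairs_length big_map/=.
  rewrite (eq_bigr (fun k => edist (p k) (q (s k)))); last first.
    by move=> k _; have [-> _] := pq k; have [_ ->] := pq (s k).
  apply; rewrite -(permPr prsJ) /unzip1 /unzip2 -!map_comp.
  rewrite (_ : prs = t)//; apply/seq.permP => P.
  have bs : (\sum_k P (b (s k)) = \sum_k P (b k))%N.
    by rewrite [RHS](reindex_perm s).
  rewrite !count_cat !count_map !count_sum !big_tuple/= bs -!big_split/=.
  apply: eq_bigr => k _.
  by rewrite /a /b; case: ifP => // _; rewrite addnC.
by apply: le_bigmin => [|s _]; exact: hs.
Qed.
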